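(* Let $n\ge 1$ be an integer and let $S_n$ be the symmetric group on $n$ letters. The values of the achievement game $\mathsf{GEN}(S_n)$ are $$\mathsf{GEN}(S_n)=\begin{cases} *0, & n\in\{1,4\},\\ *2, & n=2,\\ *3, & n=3,\\ *1, & n\ge 5.\end{cases}$$
   Context: For a finite group $G$, the achievement game $\mathsf{GEN}(G)$ is the following two-player impartial game. Starting from the empty set, the players alternately select previously-unselected elements of $G$; a position is the set $P\subseteq G$ of jointly selected elements. If $\langle P\rangle=G$ the position is terminal (it has no options, and the player who moved into it wins); otherwise the options of $P$ are the sets $P\cup\{g\}$ with $g\in G\setminus P$. (If $G$ is trivial, then the starting position $\emptyset$ is already terminal, since $\langle\emptyset\rangle=G$.) The nim-number of a position is defined recursively by $\operatorname{nim}(P)=\operatorname{mex}\{\operatorname{nim}(Q)\mid Q \text{ an option of } P\}$, where $\operatorname{mex}(A)$ is the least nonnegative integer not in $A$. The nim-number of the game is the nim-number of the starting position $\emptyset$, and $\mathsf{GEN}(G)=*k$ means that this nim-number is $k$. *)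

(* Defs.v *)
From HB Require Import structures.
From mathcomp Require Import all_boot fingroup perm.

Set Implicit Arguments.
Unset Strict Implicit.
Unset Printing Implicit Defensive.

Import GroupScope.

Lemma mex_subproof (A : seq nat) : exists k, k \notin A.
Proof.
exists (\max_(i <- A) i).+1; apply/negP => inA.
by have := @leq_bigmax_seq _ A xpredT id _ inA isT; rewrite ltnn.
Qed.

Definition mex (A : seq nat) : nat := ex_minn (mex_subproof A).

Section AchievementGame.

Variables (gT : finGroupType) (G : {group gT}).
Implicit Types P Q : {set gT}.

Definition gen_terminal P : bool := <<P>> == G.

Definition gen_options P : {set {set gT}} :=
  if gen_terminal P then set0 else [set g |: P | g in G :\: P].

(* [m] bounds the number of moves left. With [m = #|G :\: P|] the bound is    *)
(* never the reason for stopping, so [nim] satisfies the expected recursion,  *)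
(* see [nimE].                                                                *)
Fixpoint nim_rec (m : nat) P : nat :=
  if m is m'.+1 then mex [seq nim_rec m' Q | Q in gen_options P] else 0.

Definition nim P : nat := nim_rec #|G :\: P| P.

Lemma card_gen_options P Q :
  Q \in gen_options P -> #|G :\: P| = #|G :\: Q|.+1.
Proof.
rewrite /gen_options; case: ifP => _; first by rewrite inE.
case/imsetP=> g gGP ->; rewrite (cardsD1 g (G :\: P)) gGP add1n.
by rewrite setDDl setUC.
Qed.

Lemma nimE P : nim P = mex [seq nim Q | Q in gen_options P].
Proof.
rewrite {1}/nim; case Dm: #|G :\: P| => [|m] /=.
  have -> : gen_options P = set0.
    apply/setP=> Q; rewrite inE; apply/negP=> /card_gen_options.
    by rewrite Dm.
  by rewrite /image_mem enum_set0 /mex; case: ex_minnP => -[|k] // _ /(_ 0 isT).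
congr mex; apply/eq_in_map => Q; rewrite mem_enum => /card_gen_options.
by rewrite /nim Dm => -[->].
Qed.

Definition GEN : nat := nim set0.

End AchievementGame.

(* Main.v *)
Require Import Defs.
From mathcomp Require Import all_boot fingroup perm.
From mathcomp Require Import cyclic commutator quotient alt pgroup sylow action.

(** Let n >= 5. The value 1 comes from a parity argument: a nonempty
    non-generating position P of S_n has nim-number 1 exactly when #|P| is even
    ([nim_nonempty_eq1]). Two facts about S_n make the induction work.

    - Every x != 1 has a partner, an element y with <<x, y>> = S_n
      ([partner_perm]). So an even position, which contains some x != 1, has a
      generating option, of nim-number 0; its other options are odd and, by
      induction, do not have nim-number 1.
    - No maximal subgroup of S_n has odd order ([odd_order_not_maximal]): a
      subgroup of odd order consists of even permutations, and Alt is proper of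
      even order. So an odd position has an even non-generating option, whose
      nim-number is 1, and cannot itself have nim-number 1.

    Since S_n is not cyclic, all options of {1} are even positions, so {1} has
    nim-number 0, whereas {g} with g != 1 does not have nim-number 1. The empty
    set thus has an option of nim-number 0 and none of nim-number 1.

    For the existence of partners, call two points linked by a subgroup H when
    the transposition exchanging them lies in H. This is an equivalence relation
    preserved by the elements of H, and H = S_n as soon as some point is linked
    to all others. The partner of x is a product y of a transposition (a b) and
    a disjoint cycle of odd length, so that both factors are powers of y
    ([swap_cycle]). If n is odd the cycle moves all points except a and b; if n
    is even it also leaves out a third point d. The points a, b and d are chosen
    according to x so that x links everything together; for n even,
    transpositions and fixed-point-free involutions need a choice of their own,
    and the latter need n != 4.

    In S_4 the fixed-point-free involutions generate a normal four-group V, and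
    its nontrivial elements have no partner, as S_4 / V is not cyclic. Here a
    subset of V has nim-number 0 exactly when its size is even
    ([nim_sub_eq0]), which gives the value 0. The groups S_1, S_2 and S_3 are
    treated by listing the values of all positions up to symmetry. *)

Section AchievementGames.

Import GroupScope.
Set Implicit Arguments.
Unset Strict Implicit.

(** * Nim-numbers of positions *)

Lemma mex_eq (A : seq nat) (k : nat) :
  k \notin A -> (forall j, j < k -> j \in A) -> mex A = k.
Proof.
move=> kA ltA; rewrite /mex; case: ex_minnP => m mA mmin.
apply/eqP; rewrite eqn_leq mmin // leqNgt; apply/negP=> /ltA.
by rewrite (negPf mA).
Qed.

Lemma mexN (A : seq nat) : mex A \notin A.
Proof. by rewrite /mex; case: ex_minnP. Qed.

Lemma mem_nim_options (gT : finGroupType) (G : {group gT}) (P : {set gT}) k :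
  reflect (<<P>> <> G /\ exists g, [/\ g \in G, g \notin P &
             nim G (g |: P) = k])
          (k \in [seq nim G Q | Q in gen_options G P]).
Proof.
rewrite /gen_options /gen_terminal; apply: (iffP imageP).
  case=> Q; case: eqP => [|ntP]; first by rewrite inE.
  case/imsetP=> g /setDP[gG gP] -> ->; split=> //; exists g; split=> //.
case=> ntP [g [gG gP <-]]; exists (g |: P) => //; case: eqP => // _.
by apply: imset_f; rewrite inE gP.
Qed.

Lemma nim_terminal (gT : finGroupType) (G : {group gT}) (P : {set gT}) :
  <<P>> = G -> nim G P = 0.
Proof.
by move=> tP; rewrite nimE; apply: mex_eq => //; apply/mem_nim_options=> -[].
Qed.

Lemma nim_eq (gT : finGroupType) (G : {group gT}) (P : {set gT}) k :
    <<P>> <> G ->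
    (forall g, g \in G -> g \notin P -> nim G (g |: P) <> k) ->
    (forall j, j < k ->
       exists g, [/\ g \in G, g \notin P & nim G (g |: P) = j]) ->
  nim G P = k.
Proof.
move=> ntP neqk ltk; rewrite nimE; apply: mex_eq => [|j /ltk optj].
  by apply/mem_nim_options=> -[_ [g [gG gP]]]; apply: neqk.
by apply/mem_nim_options.
Qed.

Lemma nim_option_neq (gT : finGroupType) (G : {group gT}) (P : {set gT}) g :
  <<P>> <> G -> g \in G -> g \notin P -> nim G P <> nim G (g |: P).
Proof.
move=> ntP gG gP eq_nim; have := mexN [seq nim G Q | Q in gen_options G P].
by rewrite -nimE; apply/negP/negPn/mem_nim_options; split=> //; exists g.
Qed.

Definition has_partner (gT : finGroupType) (G : {group gT}) (x : gT) :=
  exists2 y, y \in G & <<[set x; y]>> = G.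

(** The partner of x completes P to a generating set. It is not already in P, as
    P would then generate G. *)
Lemma terminal_option (gT : finGroupType) (G : {group gT}) (P : {set gT}) x :
    P \subset G -> <<P>> <> G -> x \in P -> has_partner G x ->
  exists g, [/\ g \in G, g \notin P & nim G (g |: P) = 0].
Proof.
move=> sPG ntP xP [y yG genxy].
have top (Q : {set gT}) : Q \subset G -> x \in Q -> y \in Q -> <<Q>> = G.
  move=> sQG xQ yQ; apply/eqP.
  rewrite eqEsubset gen_subG sQG -genxy gen_subG /=.
  by apply/subsetP=> z /set2P[] ->; apply: mem_gen.
exists y; split=> //; first by apply/negP=> yP; apply: ntP; apply: top.
apply: nim_terminal; apply: top; rewrite ?setU11 ?inE ?xP ?orbT //.
by rewrite subUset sub1set yG.
Qed.

Lemma noncyclic_nonterminal (gT : finGroupType) (G : {group gT}) (x : gT)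
    (P : {set gT}) :
  ~~ cyclic G -> P \subset <[x]> -> <<P>> <> G.
Proof.
move=> ncG sP eqG; case/negP: ncG; rewrite -eqG.
by apply: cyclicS (cycle_cyclic x); rewrite gen_subG.
Qed.

Lemma odd_cardsU1 (T : finType) (P : {set T}) x :
  x \notin P -> odd #|x |: P| = ~~ odd #|P|.
Proof. by move=> xP; rewrite cardsU1 xP. Qed.

(** Induction on the number of unselected elements. The empty position is left
    out because it contains no x != 1 and so may lack a generating option. *)
Lemma nim_nonempty_eq1 (gT : finGroupType) (G : {group gT}) (P : {set gT}) :
    (forall x, x \in G -> x != 1 -> has_partner G x) ->
    (forall H : {group gT}, H \proper G -> odd #|H| ->
       exists2 K : {group gT}, H \proper K & K \proper G) ->
    P \subset G -> <<P>> <> G -> P != set0 ->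
  (nim G P == 1%N) = ~~ odd #|P|.
Proof.
move=> partner noOddMax; have [m] := ubnP #|G :\: P|.
elim: m P => // m IHm P ltm sPG ntP P0.
have IH g : g \in G -> g \notin P -> <<g |: P>> <> G ->
    (nim G (g |: P) == 1%N) = odd #|P|.
  move=> gG gP ntgP; rewrite IHm ?odd_cardsU1 ?negbK //.
  - rewrite -ltnS (leq_trans _ ltm) // ltnS.
    rewrite [X in _ < X](cardsD1 g) inE gP gG add1n.
    by rewrite setDDl setUC.
  - by rewrite subUset sub1set gG.
  - by apply/set0Pn; exists g; rewrite setU11.
have [oddP|evenP] := boolP (odd #|P|).
  have [g [gG gP ntgP]] : exists g, [/\ g \in G, g \notin P & <<g |: P>> <> G].
    have prP : <<P>> \proper G.
      by rewrite properEneq gen_subG sPG andbT; apply/eqP.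
    (* K is the subgroup generated by P, unless P is itself a subgroup, then of
       odd order. *)
    have [K sPK prK] : exists2 K : {group gT}, P \proper K & K \proper G.
      have [defP | neP] := eqVneq P <<P>>; last first.
        exists <<P>>%G => //; by rewrite properEneq neP subset_gen.
      have oddgP : odd #|<<P>>| by rewrite -defP.
      have [K sPK prK] := noOddMax <<P>>%G prP oddgP.
      by exists K => //; rewrite defP.
    case/properP: sPK => sPK [g gK gP]; exists g; split=> //.
      by apply: (subsetP (proper_sub prK)).
    move=> eqG; case/andP: prK => _ /negP[]; rewrite -eqG gen_subG.
    by rewrite subUset sub1set gK.
  apply/negbTE/eqP=> nim1. apply: (nim_option_neq ntP gG gP).
  by rewrite nim1; apply/esym/eqP; rewrite (IH g gG gP).
have [x xP x1] : exists2 x, x \in P & x != 1.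
  case/set0Pn: (P0) => y yP; have [y1|] := eqVneq y 1; last by exists y.
  have : P :\ 1 != set0.
    apply: contraNneq evenP => P1; rewrite (cardsD1 1) P1 cards0.
    by rewrite -y1 yP.
  by case/set0Pn=> x /setD1P[x1 xP]; exists x.
apply/eqP/nim_eq => // [g gG gP nim1 | [|//] _].
  have ntgP : <<g |: P>> <> G by move=> /nim_terminal; rewrite nim1.
  by move: evenP; rewrite -(IH g) // nim1.
apply: (terminal_option sPG ntP xP); apply: partner => //.
exact: (subsetP sPG).
Qed.

(** The move from the empty set to {1} reaches a position of nim-number 0: every
    {1, g} is even, and non-generating because G is not cyclic. *)
Lemma GEN_eq1 (gT : finGroupType) (G : {group gT}) :
    ~~ cyclic G -> 
    (forall x, x \in G -> x != 1 -> has_partner G x) ->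
    (forall H : {group gT}, H \proper G -> odd #|H| ->
       exists2 K : {group gT}, H \proper K & K \proper G) ->
  GEN G = 1%N.
Proof.
move=> ncG partner noOddMax; have nimP := nim_nonempty_eq1 partner noOddMax.
have nt1 : <<[set 1]>> <> G.
  by apply: (noncyclic_nonterminal (x := 1)); rewrite // sub1set group1.
rewrite /GEN; apply: nim_eq => [|g gG _|[|//] _].
- by apply: (noncyclic_nonterminal (x := 1)) => //; apply: sub0set.
- apply/eqP; rewrite setU0 nimP ?cards1 ?sub1set //.
    by apply: (noncyclic_nonterminal (x := g)) => //; rewrite sub1set cycle_id.
  by apply/set0Pn; exists g; rewrite inE.
exists 1; rewrite group1 inE setU0; split=> //.
apply: nim_eq => // g gG g1 nim0.
have : nim G (g |: [set 1]) == 1%N.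
  rewrite nimP ?odd_cardsU1 ?cards1 ?subUset ?sub1set ?gG ?group1 //.
    apply: (noncyclic_nonterminal (x := g)) => //.
    by rewrite subUset !sub1set cycle_id group1.
  by apply/set0Pn; exists g; rewrite setU11.
by rewrite nim0.
Qed.

(** As #|V| is even, an odd subset of V can always be enlarged inside V, to an
    even one of nim-number 0. An even subset has two kinds of options: odd
    subsets of V, and non-generating sets containing an element outside V, which
    have a generating option; none of these has nim-number 0. *)
Lemma nim_sub_eq0 (gT : finGroupType) (G V : {group gT}) (P : {set gT}) :
    V \subset G -> ~~ odd #|V| ->
    (forall x, x \in G -> x \notin V -> has_partner G x) ->
    (forall k, k \in G -> <<k |: V>> <> G) ->
    P \subset V ->
  (nim G P == 0) = ~~ odd #|P|.
Proof.
move=> sVG evenV partner noGen; have [m] := ubnP #|V :\: P|.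
elim: m P => // m IHm P ltm sPV.
have ntU g : g \in G -> <<g |: P>> <> G.
  move=> gG eqG; apply: (noGen g gG); apply/eqP; rewrite eqEsubset gen_subG.
  by rewrite subUset sub1set gG sVG -eqG genS // setUS.
have ntP : <<P>> <> G.
  move=> eqG; apply: (ntU 1 (group1 G)); apply/eqP; rewrite eqEsubset gen_subG.
  by rewrite subUset sub1set group1 (subset_trans sPV) // -eqG genS // subsetUr.
have IH g : g \in V -> g \notin P -> (nim G (g |: P) == 0) = odd #|P|.
  move=> gV gP; rewrite IHm ?odd_cardsU1 ?negbK ?subUset ?sub1set ?gV //.
  rewrite -ltnS (leq_trans _ ltm) // ltnS.
  rewrite [X in _ < X](cardsD1 g) inE gP gV add1n.
  by rewrite setDDl setUC.
have [oddP|evenP] := boolP (odd #|P|).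
  have [g gV gP] : exists2 g, g \in V & g \notin P.
    have : P \proper V.
      rewrite properEneq sPV andbT; apply: contraTneq oddP => ->.
      exact: evenV.
    by case/properP.
  apply/negbTE/eqP=> nim0; apply: (nim_option_neq ntP (subsetP sVG g gV) gP).
  by rewrite nim0; apply/esym/eqP; rewrite IH.
apply/eqP/nim_eq => // g gG gP nim0.
have [gV|gV] := boolP (g \in V).
  by case/negP: evenP; rewrite -(IH g gV gP) nim0.
have sgPG : g |: P \subset G by rewrite subUset sub1set gG (subset_trans sPV).
have [h [hG hP nimh]] :=
  terminal_option sgPG (ntU g gG) (setU11 g P) (partner g gG gV).
by apply: (nim_option_neq (ntU g gG) hG hP); rewrite nimh.
Qed.

Lemma GEN_eq0 (gT : finGroupType) (G V : {group gT}) :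
    V \subset G -> ~~ odd #|V| ->
    (forall x, x \in G -> x \notin V -> has_partner G x) ->
    (forall k, k \in G -> <<k |: V>> <> G) ->
  GEN G = 0.
Proof.
move=> sVG evenV partner noGen; apply/eqP; rewrite /GEN.
by rewrite (nim_sub_eq0 (V := V)) ?cards0 ?sub0set.
Qed.

(** * Partners of permutations *)

Lemma mem_tperm_trans (T : finType) (H : {group {perm T}}) u v w :
  tperm u v \in H -> tperm v w \in H -> tperm u w \in H.
Proof.
move=> uvH vwH; have [->//|uw] := eqVneq w v.
have [->|uw'] := eqVneq w u; first by rewrite tperm1 group1.
have := groupJ uvH vwH; rewrite tpermJ tpermL.
have [uv|uv] := eqVneq u v; first by rewrite uv.
by rewrite tpermD // eq_sym.
Qed.

Lemma mem_tperm_act (T : finType) (H : {group {perm T}}) (s : {perm T}) u v :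
  s \in H -> tperm u v \in H -> tperm (s u) (s v) \in H.
Proof. by move=> sH uvH; rewrite -tpermJ groupJ. Qed.

(** Together with [mem_tperm_trans] and [mem_tperm_act], this makes
    [tperm u v \in H] an H-invariant equivalence relation that detects whether H
    is the full symmetric group. *)
Lemma mem_tperm_full (T : finType) (H : {group {perm T}}) u :
  (forall v, tperm u v \in H) -> H = [set: {perm T}] :> {set _}.
Proof.
move=> uH; apply/eqP; rewrite eqEsubset subsetT -(gen_tperm u) gen_subG.
by apply/subsetP=> _ /imsetP[v _ ->].
Qed.

(** A cycle running through C, obtained from the successor function of an
    enumeration of C. *)
Lemma cycle_on (T : finType) (C : {set T}) :
  exists c : {perm T}, [/\ forall u, u \notin C -> c u = u, #[c] %| #|C|
    & forall u v, u \in C -> v \in C -> exists i, (c ^+ i) u = v].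
Proof.
have Ue := enum_uniq (mem C); have cyc := cycle_next Ue.
exists (perm (can_inj (prev_next Ue))).
set c := perm _; have cE u : c u = next (enum C) u by rewrite permE.
have cX i u : (c ^+ i) u = iter i (next (enum C)) u.
  by rewrite permX; apply: eq_iter.
have out u : u \notin C -> c u = u.
  by move=> uC; rewrite cE next_nth mem_enum (negPf uC).
split=> // [|u v uC vC].
  rewrite order_dvdn; apply/eqP/permP=> u; rewrite perm1.
  have [uC|/out uC] := boolP (u \in C); last by rewrite permX_fix.
  rewrite cX cardE -(order_cycle cyc Ue (x := u)) ?mem_enum //.
  by rewrite (iter_order_cycle cyc) ?mem_enum.
exists (findex (next (enum C)) u v).
by rewrite cX iter_findex // (fconnect_cycle cyc) ?mem_enum.
Qed.

(** The two factors of [tperm a b * c] commute and have coprime orders, hence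
    are powers of the product. A point fixed by c and linked to one point of C
    is then linked to all of C, by applying powers of c. When a = b the product is
    just the odd cycle c. *)
Lemma swap_cycle (T : finType) (a b : T) (C : {set T}) :
    a \notin C -> b \notin C -> odd #|C| ->
  exists y : {perm T}, forall H : {group {perm T}}, y \in H ->
    tperm a b \in H /\ (forall d p q, d \notin C -> p \in C -> q \in C ->
       tperm d p \in H -> tperm d q \in H).
Proof.
move=> aC bC oddC; have [c [c_out c_ord c_trans]] := cycle_on C.
have com : commute (tperm a b) c.
  by apply/commgP/conjg_fixP; rewrite tpermJ !c_out.
have cop : coprime #[tperm a b] #[c].
  apply: (@coprime_dvdl _ 2); first by rewrite order_dvdn expgS expg1 tperm2.
  by rewrite coprime2n (dvdn_odd c_ord).
exists (tperm a b * c) => H yH.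
have abH : tperm a b \in H.
  have sH : <[tperm a b * c]> \subset H by rewrite cycle_subG.
  by apply: (subsetP (subset_trans (cycleMsub com cop) sH)); apply: cycle_id.
split=> // d p q dC pC qC dpH.
have cH : c \in H by rewrite -(groupMl c abH).
have [i <-] := c_trans p q pC qC.
rewrite -{1}[d](permX_fix i (c_out d dC)).
by apply: mem_tperm_act => //; apply: groupX.
Qed.

(** It suffices to consider subgroups H containing x and y, which allows the
    linking arguments to be carried out in an arbitrary such H. *)
Lemma perm_partner (T : finType) (x y : {perm T}) :
    (forall H : {group {perm T}}, x \in H -> y \in H ->
       exists u, forall v, tperm u v \in H) ->
  has_partner [set: {perm T}]%G x.
Proof.
move=> gen; exists y => //.
have [||u uH] := gen <<[set x; y]>>%G.
- by rewrite mem_gen // !inE eqxx.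
- by rewrite mem_gen // !inE eqxx orbT.
exact: mem_tperm_full uH.
Qed.

Definition free_involution (T : finType) (x : {perm T}) :=
  (x * x == 1) && [forall u, x u != u].

Lemma free_involutionP (T : finType) (x : {perm T}) :
  reflect ((forall u, x (x u) = u) /\ (forall u, x u != u)) (free_involution x).
Proof.
apply: (iffP andP) => -[].
  by move=> /eqP/permP x2 /forallP fx; split=> // u; rewrite -permM x2 perm1.
move=> x2 fx; split; last by apply/forallP.
by apply/eqP/permP=> u; rewrite permM x2 perm1.
Qed.

(** In both cases x maps b, but not a, outside {a, b}: once a and b are linked,
    both are linked with x b. The absence of fixed points recorded in the second
    case leaves every further point available as the d of [partner_even]. *)
Lemma moving_pair (T : finType) (x : {perm T}) :
    x != 1 -> ~~ free_involution x ->
  exists a b, [/\ a != b, x b != a, x b != b &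
     x a = a \/ (x a = b /\ forall u, x u != u)].
Proof.
move=> x1 nfx.
have [b xb] : exists b, x b != b.
  apply/existsP; apply: contraR x1; rewrite negb_exists => /forallP fx.
  by apply/eqP/permP=> u; rewrite perm1; apply/eqP/negPn.
have [/existsP[a /eqP xa]|] := boolP [exists a, x a == a].
  exists a, b; split=> //; last by left.
    by apply: contraNneq xb => <-; rewrite xa.
  by apply: contraNneq xb => xba; apply/eqP/(@perm_inj _ x); rewrite xba xa.
rewrite negb_exists => /forallP fx.
have [a xxa] : exists a, x (x a) != a.
  apply/existsP; apply: contraR nfx; rewrite negb_exists => /forallP x2.
  by apply/free_involutionP; split=> // u; apply/eqP/negPn.
exists a, (x a); split=> //; first by rewrite eq_sym.
by right.
Qed.

(** The partner has a and b as its 2-cycle and an odd cycle on all other points,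
    among which is x b; so a is linked to b, to x b, and thus to the cycle. *)
Lemma partner_odd (T : finType) (x : {perm T}) :
    odd #|T| -> x != 1 -> ~~ free_involution x ->
  has_partner [set: {perm T}]%G x.
Proof.
move=> oddT x1 nfx; have [a [b [ab xba xbb xa]]] := moving_pair x1 nfx.
have [||| y gen] := @swap_cycle T a b (~: [set a; b]).
- by rewrite !inE eqxx.
- by rewrite !inE eqxx orbT.
- by move: oddT; rewrite -(cardsC [set a; b]) cards2 ab oddD.
apply: (@perm_partner T x y) => H xH /gen[abH rot].
have axbH : tperm a (x b) \in H.
  have := mem_tperm_act xH abH; case: xa => [->|[-> _]] //.
  exact: mem_tperm_trans.
exists a => v; have [->|va] := eqVneq v a; first by rewrite tperm1 group1.
have [->//|vb] := eqVneq v b.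
by apply: rot axbH; rewrite !inE ?eqxx // negb_or; apply/andP.
Qed.

(** The cycle must have odd length and so leaves out a third point d. If x moves
    d then d gets linked to the rest, since all other points are linked to a.
    Such a d, distinct also from x b, exists unless x is a transposition. *)
Lemma partner_even (T : finType) (x : {perm T}) :
    ~~ odd #|T| -> 2 < #|T| -> x != 1 -> ~~ free_involution x ->
    (forall u v, x != tperm u v) ->
  has_partner [set: {perm T}]%G x.
Proof.
move=> evenT T3 x1 nfx ntx; have [a [b [ab xba xbb xa]]] := moving_pair x1 nfx.
have [d [da db dxb xd]] : exists d, [/\ d != a, d != b, d != x b & x d != d].
  case: xa => [xa|[xa fx]].
    have /existsP[d /and3P[db dxb xd]] :
        [exists d, [&& d != b, d != x b & x d != d]].
      apply: contraR (ntx b (x b)); rewrite negb_exists => /forallP fx.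
      have {}fx d : d != b -> d != x b -> x d = d.
        by move=> db dxb; have := fx d; rewrite db dxb negbK => /eqP.
      (* Now x moves at most b and x b, so it exchanges them. *)
      have xxb : x (x b) = b.
        have [//|xxb] := eqVneq (x (x b)) b.
        have := fx _ xxb; rewrite (inj_eq perm_inj) => /(_ xbb).
        by move/perm_inj/perm_inj/eqP; rewrite (negPf xbb).
      apply/eqP/permP=> d; case: tpermP => [->|->|/eqP db /eqP dxb] //.
      exact: fx.
    by exists d; split=> //; apply: contraNneq xd => ->; rewrite xa.
  have card3 : #|[set a; b; x b]| = 3.
    by rewrite setUC cardsU1 !inE negb_or xba xbb cards2 ab.
  have : ~: [set a; b; x b] != set0.
    rewrite -card_gt0; have := cardsC [set a; b; x b]; rewrite card3.
    by case: #|_| => // T3'; move: evenT; rewrite -T3'.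
  case/set0Pn=> d; rewrite !inE !negb_or -andbA => /and3P[da db dxb].
  by exists d.
have [||| y gen] := @swap_cycle T a b (~: [set a; b; d]).
- by rewrite !inE eqxx.
- by rewrite !inE eqxx orbT.
- move: evenT; rewrite -(cardsC [set a; b; d]) setUC cardsU1 !inE negb_or.
  by rewrite da db cards2 ab oddD /= negbK.
apply: (@perm_partner T x y) => H xH /gen[abH rot].
have axbH : tperm a (x b) \in H.
  have := mem_tperm_act xH abH; case: xa => [->|[-> _]] //.
  exact: mem_tperm_trans.
have aH v : v != d -> tperm a v \in H.
  move=> vd; have [->|va] := eqVneq v a; first by rewrite tperm1 group1.
  have [->//|vb] := eqVneq v b.
  apply: rot axbH; rewrite !inE ?eqxx // !negb_or -?andbA; apply/and3P; split=> //.
  by rewrite eq_sym.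
exists a => v; have [->|] := eqVneq v d; last exact: aH.
have axaH : tperm a (x a) \in H.
  apply: aH; case: xa => [->|[-> _]]; by rewrite eq_sym.
(* The point x^-1 d is not d, so it is linked to a; then d is linked to x a. *)
apply: mem_tperm_trans axaH _; rewrite tpermC.
have := aH (x^-1 d); rewrite -(inj_eq (@perm_inj _ x)) permKV eq_sym => /(_ xd).
by rewrite tpermC => /(mem_tperm_act xH); rewrite permKV.
Qed.

(** The partner is a cycle on all points but u: it links u, through v, to
    everything. *)
Lemma partner_tperm (T : finType) (u v : T) :
  ~~ odd #|T| -> u != v -> has_partner [set: {perm T}]%G (tperm u v).
Proof.
move=> evenT uv; have [||| y gen] := @swap_cycle T u u (~: [set u]).
- by rewrite !inE eqxx.
- by rewrite !inE eqxx.
- by move: evenT; rewrite -(cardsC [set u]) cards1 oddD /= negbK.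
apply: (@perm_partner T _ y) => H uvH /gen[_ rot].
exists u => w; have [->|wu] := eqVneq w u; first by rewrite tperm1 group1.
by apply: rot uvH; rewrite !inE ?eqxx // eq_sym.
Qed.

(** Choosing b different from x a makes {x a, x b} disjoint from {a, b}. The cycle
    omits a, b and d = x b but contains x a. Applying x to the link between a and
    b links d to x a, hence to the whole cycle. With more than four points the
    cycle contains some q outside {a, b, x a, x b}, and then also x q; both are
    linked to d, and applying x to the link between d and q joins b to x q. *)
Lemma partner_free_involution (T : finType) (x : {perm T}) :
    ~~ odd #|T| -> 4 < #|T| -> free_involution x ->
  has_partner [set: {perm T}]%G x.
Proof.
move=> evenT T5 /free_involutionP[x2 fx].
have outside (A : {set T}) : #|A| <= 4 -> exists v, v \notin A.
  move=> leA; have : ~: A != set0.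
    by rewrite -card_gt0 -(ltn_add2l #|A|) cardsC addn0 (leq_ltn_trans leA).
  by case/set0Pn=> v; rewrite inE; exists v.
have card4 (c d e f : T) : #|[set c; d; e; f]| <= 4.
  by do 3!rewrite setUC cardsU1; rewrite cards1; do 3!case: (_ \notin _).
have [a _] : exists a, a \notin @set0 T by apply: outside; rewrite cards0.
have [b] : exists b, b \notin [set a; a; a; x a] by apply: outside.
rewrite !inE !negb_or -!andbA => /and4P[_ _ ba bxa].
have xba : x b != a by apply: contraNneq bxa => <-; rewrite x2.
have [||| y gen] := @swap_cycle T a b (~: [set a; b; x b]).
- by rewrite !inE eqxx.
- by rewrite !inE eqxx orbT.
- move: evenT; rewrite -(cardsC [set a; b; x b]) setUC cardsU1 !inE negb_or.
  by rewrite xba fx cards2 eq_sym ba oddD /= negbK.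
apply: (@perm_partner T x y) => H xH /gen[abH rot].
have [q] : exists q, q \notin [set a; b; x b; x a] by apply: outside.
rewrite !inE !negb_or -!andbA => /and4P[qa qb qxb qxa].
have axbH : tperm (x b) (x a) \in H by rewrite tpermC mem_tperm_act.
have dH v : v != a -> v != b -> v != x b -> tperm (x b) v \in H.
  move=> va vb vxb; apply: rot axbH; rewrite !inE ?eqxx ?orbT // !negb_or.
    by rewrite fx eq_sym bxa (inj_eq perm_inj) eq_sym ba.
  by rewrite va vb vxb.
have bdH : tperm b (x b) \in H.
  have dqH : tperm (x b) q \in H by apply: dH.
  have bxqH : tperm b (x q) \in H by rewrite -{1}(x2 b) mem_tperm_act.
  apply: mem_tperm_trans bxqH _; rewrite tpermC; apply: dH.
  - by apply: contraNneq qxa => <-; rewrite x2.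
  - by apply: contraNneq qxb => <-; rewrite x2.
  - by rewrite (inj_eq perm_inj).
exists (x b) => v; have [->|vb] := eqVneq v b; first by rewrite tpermC.
have [->|va] := eqVneq v a.
  by rewrite tpermC; apply: mem_tperm_trans abH bdH.
have [->|vxb] := eqVneq v (x b); first by rewrite tperm1 group1.
exact: dH.
Qed.

(** The cyclic group generated by x is a 2-group without fixed points. *)
Lemma free_involution_even (T : finType) (x : {perm T}) :
  free_involution x -> ~~ odd #|T|.
Proof.
move=> /free_involutionP[x2 fx].
have x_ord : #[x] %| 2.
  rewrite order_dvdn expgS expg1; apply/eqP/permP=> u.
  by rewrite permM perm1 x2.
have p2 : 2.-group <[x]> by rewrite /pgroup -orderE (pnat_dvd x_ord).
have acts : [acts <[x]>, on [set: T] | 'P] by apply/actsP=> y _ u; rewrite !inE.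
have := pgroup_fix_mod p2 acts.
have -> : 'Fix_([set: T] | 'P)(<[x]>) = set0.
  apply/setP=> u; rewrite in_set0; apply/negP=> /setIP[_ /afixP fixu].
  by have /eqP := fixu x (cycle_id x); rewrite /= /aperm (negPf (fx u)).
by rewrite cards0 cardsT mod0n modn2; case: (odd _).
Qed.

Lemma partner_perm (T : finType) (x : {perm T}) :
    2 < #|T| -> (free_involution x -> #|T| != 4) -> x != 1 ->
  has_partner [set: {perm T}]%G x.
Proof.
move=> T3 nx4 x1; have [fx|nfx] := boolP (free_involution x).
  have evenT := free_involution_even fx.
  apply: partner_free_involution => //; move: (nx4 fx) evenT T3.
  by case: #|T| => [|[|[|[|[|]]]]].
have [oddT|evenT] := boolP (odd #|T|); first exact: partner_odd.
have [/existsP[[u v] /= /eqP xE]|] :=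
  boolP [exists t : T * T, x == tperm t.1 t.2].
  rewrite xE; apply: partner_tperm => //; apply: contraNneq x1 => uv.
  by rewrite xE uv tperm1.
rewrite negb_exists => /forallP ntx; apply: partner_even => // u v.
exact: ntx (u, v).
Qed.

(** * Symmetric groups on at least five points *)

Lemma perm_noncyclic (T : finType) : 2 < #|T| -> ~~ cyclic [set: {perm T}].
Proof.
case/card_gt2P=> a [b [c [_ [ab bc ca]]]].
apply/negP=> /cyclic_abelian/centsP com.
have /commgP/conjg_fixP := com (tperm a b) (in_setT _) (tperm b c) (in_setT _).
have ba : b != a by rewrite eq_sym.
rewrite tpermJ tpermL (tpermD ba ca) => /permP/(_ a).
by rewrite !tpermL => cb; rewrite cb eqxx in bc.
Qed.

Lemma odd_order_sub_Alt (T : finType) (H : {group {perm T}}) :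
  odd #|H| -> H \subset 'Alt_T.
Proof.
move=> oddH; apply/subsetP=> x xH; rewrite Alt_even.
have oddX n : odd_perm (x ^+ n) = odd n && odd_perm x.
  elim: n => [|n IHn]; first by rewrite odd_perm1.
  by rewrite expgS odd_permM IHn /=; case: (odd n) (odd_perm x) => -[].
by have := oddX #|H|; rewrite expg_cardG // odd_perm1 oddH /= => <-.
Qed.

Lemma Alt_proper (T : finType) : 1 < #|T| -> 'Alt_T \proper [set: {perm T}].
Proof.
case/card_gt1P=> a [b [_ _ ab]]; rewrite properEneq subsetT andbT.
by apply/eqP=> /setP/(_ (tperm a b)); rewrite Alt_even odd_tperm ab inE.
Qed.

Lemma odd_order_not_maximal (T : finType) (H : {group {perm T}}) :
    3 < #|T| -> odd #|H| ->
  exists2 K : {group {perm T}}, H \proper K & K \proper [set: {perm T}].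
Proof.
move=> T4 oddH; have T2 : 1 < #|T| by apply: leq_trans T4.
exists 'Alt_T%G; last exact: Alt_proper.
rewrite properEneq odd_order_sub_Alt // andbT; apply: contraTneq oddH => ->.
rewrite -dvdn2 -(@dvdn_pmul2l 2) // card_Alt //.
by apply: dvdn_trans (dvdn_fact (m := 4) _); rewrite // T4.
Qed.

Lemma GEN_perm_ge5 (T : finType) : 4 < #|T| -> GEN [set: {perm T}]%G = 1%N.
Proof.
move=> T5; apply: GEN_eq1 => [|x _ x1|H _ oddH].
- by apply: perm_noncyclic; apply: leq_trans T5.
- apply: partner_perm => // [|_]; first exact: leq_trans T5.
  by rewrite neq_ltn T5 orbT.
by apply: odd_order_not_maximal => //; apply: leq_trans T5.
Qed.

(** * Small symmetric groups *)

(** If x u != y u, then x (y u) and y (x u) both differ from u, x u and y u, so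
    both are the fourth point. *)
Lemma free_involution_commute (T : finType) (x y : {perm T}) :
  #|T| = 4 -> free_involution x -> free_involution y -> commute x y.
Proof.
move=> T4 /free_involutionP[x2 fx] /free_involutionP[y2 fy].
apply/permP=> u; rewrite !permM.
have [xyu|xyu] := eqVneq (x u) (y u); first by rewrite xyu y2 -xyu x2.
have card3 : #|[set u; x u; y u]| = 3.
  by rewrite setUC cardsU1 !inE negb_or fy eq_sym xyu cards2 eq_sym fx.
have /eqP/cards1P[w compl] : #|~: [set u; x u; y u]| = 1%N.
  by apply/eqP; rewrite -(eqn_add2l 3) -{1}card3 cardsC T4.
have -> : y (x u) = w.
  apply/set1P; rewrite -compl !inE !negb_or fy (inj_eq perm_inj) fx.
  by rewrite !andbT; apply: contraNneq xyu => yxu; rewrite -{2}yxu y2.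
apply/esym/set1P; rewrite -compl !inE !negb_or fx (inj_eq perm_inj) fy.
by rewrite !andbT; apply: contraNneq xyu => xyu; rewrite -{1}xyu x2.
Qed.

Lemma free_involution_exists (T : finType) :
  #|T| = 4 -> exists x : {perm T}, free_involution x.
Proof.
move=> T4; have /card_gt1P[a [b [_ _ ab]]] : 1 < #|T| by rewrite T4.
have /eqP/cards2P[c [d [cd compl]]] : #|~: [set a; b]| = 2.
  apply/eqP; rewrite -(eqn_add2l 2) -{1}(_ : #|[set a; b]| = 2).
    by rewrite cardsC T4.
  by rewrite cards2 ab.
exists (tperm a b * tperm c d); apply/free_involutionP.
have cdP u : (u \in [set c; d]) = (u != a) && (u != b).
  by rewrite -compl !inE negb_or.
have /andP[ca cb] : (c != a) && (c != b) by rewrite -cdP !inE eqxx.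
have /andP[da db] : (d != a) && (d != b) by rewrite -cdP !inE eqxx orbT.
have tac : (tperm c d a = a) * (tperm c d b = b) * (tperm a b c = c)
    * (tperm a b d = d).
  by rewrite !tpermD // eq_sym.
have cases u : [\/ u = a, u = b, u = c | u = d].
  have [->|ua] := eqVneq u a; first by constructor 1.
  have [->|ub] := eqVneq u b; first by constructor 2.
  have := cdP u; rewrite ua ub => /set2P[->|->]; first by constructor 3.
  by constructor 4.
split=> u; rewrite !permM; case: (cases u) => ->;
  by rewrite ?(tac, tpermL, tpermR) // eq_sym.
Qed.

(** [GEN_eq0] applies to the subgroup V generated by the fixed-point-free
    involutions. If V and k generated the group, then V would contain the
    derived subgroup and hence a 3-cycle; but V is abelian, and a 3-cycle with
    fixed point d does not commute with an involution moving d. *)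
Lemma GEN_perm4 (T : finType) : #|T| = 4 -> GEN [set: {perm T}]%G = 0.
Proof.
move=> T4; pose S := [set x : {perm T} | free_involution x].
have [v fv] := free_involution_exists T4.
have vV : v \in <<S>> by rewrite mem_gen // inE.
have /free_involutionP[v2 v_free] := fv.
have abV : abelian <<S>>.
  rewrite abelian_gen; apply/centsP=> x; rewrite inE => fx y; rewrite inE => fy.
  exact: free_involution_commute.
have nV : [set: {perm T}] \subset 'N(<<S>>).
  apply: norms_gen; apply/subsetP=> g _; rewrite inE.
  apply/subsetP=> w /imsetP[x].
  rewrite !inE => /free_involutionP[x2 fx] ->{w}; apply/free_involutionP.
  have xJ u : (x ^ g) u = g (x (g^-1 u)) by rewrite conjgE !permM.
  split=> u; first by rewrite !xJ permK x2 permKV.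
  by rewrite xJ -{2}(permKV g u) (inj_eq perm_inj).
apply: (GEN_eq0 (V := <<S>>%G)) => [||x _ xV|k _ genk].
- exact: subsetT.
- rewrite -dvdn2 (dvdn_trans _ (order_dvdG vV)) //.
  have -> : #[v] = 2; last by [].
  apply: nt_prime_order => //; first by apply/permP=> u; rewrite permM perm1 v2.
  have /card_gt0P[u _] : 0 < #|T| by rewrite T4.
  by apply: contraNneq (v_free u) => ->; rewrite perm1.
- apply: partner_perm; rewrite ?T4 //.
    by move=> fx; case/negP: xV; rewrite mem_gen // inE.
  by apply: contraNneq xV => ->; rewrite group1.
have genYk : [set: {perm T}] = <<S>> <*> <[k]>.
  by rewrite -[LHS]genk setUC joing_idr.
have : [set: {perm T}]^`(1) \subset <<S>>.
  apply: der1_min => //; rewrite /= genYk quotientYidl.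
    by rewrite quotient_abelian ?cycle_abelian.
  exact: subset_trans (subsetT _) nV.
move/subsetP=> derV.
have /card_gt0P[d _] : 0 < #|T| by rewrite T4.
pose a := v d.
have [b] : exists b, b \notin [set a; d].
  have : ~: [set a; d] != set0.
    rewrite -card_gt0 -(ltn_add2l #|[set a; d]|) cardsC T4 addn0 cards2.
    by case: (_ != _).
  by case/set0Pn=> b; rewrite inE; exists b.
rewrite !inE negb_or => /andP[ba bd].
have [c] : exists c, c \notin [set b; a; d].
  have : ~: [set b; a; d] != set0.
    rewrite -card_gt0 -(ltn_add2l #|[set b; a; d]|) cardsC T4 addn0.
    by rewrite setUC cardsU1 cards2; case: (_ != _); case: (_ \notin _).
  by case/set0Pn=> c; rewrite inE; exists c.
rewrite !inE !negb_or -andbA => /and3P[cb ca cd].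
have ad : a != d by apply: v_free.
have zV : [~ tperm a b, tperm b c] \in <<S>>.
  by apply: derV; apply: mem_commg; rewrite inE.
have zE : [~ tperm a b, tperm b c] = tperm a b * tperm a c.
  by rewrite commgEl tpermV tpermJ tpermL tpermD // eq_sym.
have /permP/(_ d) := centsP abV _ vV _ zV.
rewrite zE !permM -/a tpermL.
have ab : a != b by rewrite eq_sym.
rewrite (tpermD ab cb) (tpermD ad bd) (tpermD ad cd) => /eqP.
by rewrite (negPf ba).
Qed.

Lemma GEN_trivial (gT : finGroupType) (G : {group gT}) : G :=: 1 -> GEN G = 0.
Proof. by move=> G1; apply: nim_terminal; rewrite gen0 G1. Qed.

Lemma GEN_order2 (gT : finGroupType) (G : {group gT}) : #|G| = 2 -> GEN G = 2.
Proof.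
move=> G2.
have [t tG t1] : exists2 t, t \in G & t != 1.
  by apply/trivgPn; rewrite -cardG_gt1 G2.
have top (P : {set gT}) g :
    g \in G -> g != 1 -> P \subset G -> g \in P -> <<P>> = G.
  move=> gG g1 sPG gP; apply/eqP; rewrite eqEcard gen_subG sPG G2.
  have {1}<- : #[g] = 2.
    apply: nt_prime_order => //; rewrite -G2; exact: expg_cardG.
  by rewrite subset_leq_card // cycle_subG mem_gen.
have nt (P : {set gT}) : P \subset [1 gT] -> <<P>> <> G.
  rewrite -(gen_subG _ 1) => /subsetP sP1 eqG; move: (sP1 t).
  by rewrite eqG tG inE (negPf t1) => /(_ isT).
have nim1 : nim G [set 1] = 1%N.
  apply: nim_eq => [|g gG g1|[|//] _]; first exact: nt.
    rewrite (@nim_terminal _ G) // (top _ g) ?setU11 -?in_set1 //.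
    by rewrite subUset !sub1set gG group1.
  exists t; rewrite in_set1 tG t1; split=> //; apply: nim_terminal.
  by rewrite (top _ t) ?setU11 // subUset !sub1set tG group1.
have nimt g : g \in G -> g != 1 -> nim G [set g] = 0.
  move=> gG g1; apply: nim_terminal.
  by apply: (top _ g); rewrite ?sub1set ?in_set1.
apply: nim_eq => [|g gG _|j].
- exact/nt/sub0set.
- rewrite setU0; have [->|g1] := eqVneq g 1; first by rewrite nim1.
  by rewrite nimt.
case: j => [|[|//]] _.
  by exists t; rewrite inE setU0 nimt.
by exists 1; rewrite inE setU0 nim1 group1.
Qed.

(** The subgroup generated by P has even order, for it contains an odd
    permutation, and this order is a proper divisor of 6: it is 2. *)
Lemma nonterminal_with_odd (T : finType) (P : {set {perm T}}) t :
    #|T| = 3 -> t \in P -> odd_perm t -> <<P>> <> [set: {perm T}] ->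
  P \subset [set 1; t].
Proof.
move=> T3 tP odd_t ntP.
have cardS : #|[set: {perm T}]| = 6.
  by rewrite [LHS](card_Sym T) T3.
have card2 : #|<<P>>| <= 2.
  have : #|<<P>>| %| 6 by rewrite -cardS; apply/cardSg/subsetT.
  have : #|<<P>>| <> 6.
    by move=> eq6; apply: ntP; apply/eqP; rewrite eqEcard subsetT cardS eq6.
  have : ~~ odd #|<<P>>|.
    apply/negP=> /odd_order_sub_Alt/subsetP/(_ t (mem_gen tP)).
    by rewrite Alt_even odd_t.
  by case: #|_| => [|[|[|[|[|[|[|n]]]]]]] // _ _; rewrite dvdn_leq.
have -> : [set 1; t] = <<P>>; last exact: subset_gen.
apply/eqP; rewrite eqEcard subUset !sub1set group1 mem_gen //= cards2 eq_sym.
by have -> : t != 1 by apply: contraTneq odd_t => ->; rewrite odd_perm1.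
Qed.

(** With t odd, c a 3-cycle and P a subset of Alt, the non-generating positions
    have nim-numbers 2 for {t}, 1 for {1, t}, 0 for {1}, 1 for {c}, and 4 - #|P|
    when P has two or three elements. *)
Lemma GEN_perm3 (T : finType) : #|T| = 3 -> GEN [set: {perm T}]%G = 3.
Proof.
move=> T3; set G := [set: {perm T}]%G.
have ncG : ~~ cyclic G by apply: perm_noncyclic; rewrite T3.
have cardA : #|'Alt_T| = 3.
  by apply/eqP; rewrite -(@eqn_pmul2l 2) // card_Alt ?T3.
have even1 : odd_perm (1 : {perm T}) = false by rewrite odd_perm1.
have top (P : {set {perm T}}) t g : t \in P -> g \in P -> odd_perm t ->
    g != 1 -> g != t -> <<P>> = G.
  move=> tP gP odd_t g1 gt; apply/eqP/contraT => /eqP.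
  move/(nonterminal_with_odd T3 tP odd_t).
  by move/subsetP/(_ g gP); rewrite !inE (negPf g1) (negPf gt).
have [t odd_t] : exists t : {perm T}, odd_perm t.
  have T2 : 1 < #|T| by rewrite T3.
  by have /properP[_ [t _]] := Alt_proper T2; rewrite Alt_even negbK; exists t.
have [c evc c1] : exists2 c : {perm T}, ~~ odd_perm c & c != 1.
  have : 'Alt_T != 1 :> {set {perm T}} by rewrite -cardG_gt1 cardA.
  by case/trivgPn=> c; rewrite Alt_even; exists c.
have ntA (P : {set {perm T}}) : P \subset 'Alt_T -> <<P>> <> G.
  move=> sPA eqG; have : odd_perm t = false; last by rewrite odd_t.
  apply/negbTE; rewrite -Alt_even (subsetP (_ : <<P>> \subset _)) ?gen_subG //.
  by rewrite eqG inE.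
have nim1t g : odd_perm g -> nim G [set 1; g] = 1%N.
  move=> odd_g; apply: nim_eq => [|h _|[|//] _].
  - apply: (noncyclic_nonterminal (x := g)) => //.
    by rewrite subUset !sub1set group1 cycle_id.
  - rewrite !inE negb_or => /andP[h1 hg].
    by rewrite (@nim_terminal _ G) // (top _ g h) ?setU11 // !inE eqxx !orbT.
  exists c; rewrite !inE negb_or c1; have cg : c != g.
    by apply: contraNneq evc => ->.
  split=> //; apply: nim_terminal.
  by rewrite (top _ g c) ?setU11 // !inE eqxx !orbT.
have nimt g : odd_perm g -> nim G [set g] = 2.
  move=> odd_g; have g1 : g != 1.
    by apply: contraTneq odd_g => ->; rewrite odd_perm1.
  apply: nim_eq => [|h _|j].
  - by apply: (noncyclic_nonterminal (x := g)) => //; rewrite sub1set cycle_id.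
  - rewrite !inE => hg; have [->|h1] := eqVneq h 1; first by rewrite nim1t.
    by rewrite (@nim_terminal _ G) // (top _ g h) ?setU11 // !inE eqxx !orbT.
  case: j => [|[|//]] _; last by exists 1; rewrite !inE eq_sym g1 nim1t.
  exists c; rewrite !inE; have cg : c != g.
    by apply: contraNneq evc => ->.
  split=> //; apply: nim_terminal.
  by rewrite (top _ g c) ?setU11 // !inE eqxx !orbT.
have nim_odd (P : {set {perm T}}) u g :
    u \in P -> u != 1 -> ~~ odd_perm u -> odd_perm g ->
    nim G (g |: P) = 0.
  move=> uP u1 evu odd_g; apply: nim_terminal.
  rewrite (top _ g u) ?setU11 ?inE ?uP ?orbT //.
  by apply: contraNneq evu => ->.
have nimA (P : {set {perm T}}) :
    P \subset 'Alt_T -> 1 < #|P| -> nim G P = 4 - #|P|.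
  have [m] := ubnP (3 - #|P|); elim: m P => // m IHm P ltm sPA P2.
  have [u uP u1] : exists2 u, u \in P & u != 1.
    case/card_gt1P: (P2)=> u [w [uP wP uw]].
    have [u1|] := eqVneq u 1; last by exists u.
    by exists w; rewrite // -u1 eq_sym.
  have evu : ~~ odd_perm u by rewrite -Alt_even (subsetP sPA).
  have leP3 : #|P| <= 3 by rewrite -cardA subset_leq_card.
  have nim_even g : ~~ odd_perm g -> g \notin P ->
      #|P| = 2 /\ nim G (g |: P) = 1%N.
    move=> evg gP; have cgP : #|g |: P| = #|P|.+1 by rewrite cardsU1 gP.
    have sgPA : g |: P \subset 'Alt_T by rewrite subUset sub1set Alt_even evg.
    have leg : #|g |: P| <= 3 by rewrite -cardA subset_leq_card.
    have P2' : #|P| = 2 by apply/eqP; rewrite eqn_leq P2 -ltnS -cgP leg.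
    by split=> //; move: ltm; rewrite P2' => ltm; rewrite IHm // cgP P2'.
  apply: nim_eq => [|g _ gP|j ltj]; first exact: ntA.
    have [odd_g|evg] := boolP (odd_perm g).
      by rewrite (nim_odd P u g) //; move: leP3; case: #|P| => [|[|[|[|]]]].
    by have [-> ->] := nim_even g evg gP.
  case: j ltj => [|j] ltj.
    exists t; rewrite inE (nim_odd P u t) //; split=> //.
    by apply/negP=> /(subsetP sPA); rewrite Alt_even odd_t.
  have {ltj}[P2' ->] : #|P| = 2 /\ j = 0.
    by move: ltj P2; case: #|P| => [|[|[|[|n]]]] //; case: j.
  have : P \proper 'Alt_T by rewrite properEcard sPA cardA P2'.
  case/properP=> _ [g]; rewrite Alt_even => evg gP; exists g; rewrite inE.
  by have [_ ->] := nim_even g evg gP.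
have nim_pair (a b : {perm T}) :
    ~~ odd_perm a -> ~~ odd_perm b -> a != b -> nim G (a |: [set b]) = 2.
  move=> eva evb ab; have card_ab : #|a |: [set b]| = 2 by rewrite cards2 ab.
  by rewrite nimA ?[#|_|]card_ab // subUset !sub1set !Alt_even eva evb.
have nimc g : ~~ odd_perm g -> g != 1 -> nim G [set g] = 1%N.
  move=> evg g1; apply: nim_eq => [|h _|[|//] _].
  - by apply: ntA; rewrite sub1set Alt_even.
  - rewrite inE => hg; have [odd_h|evh] := boolP (odd_perm h).
      by rewrite (nim_odd _ g) ?inE.
    by rewrite nim_pair.
  exists t; rewrite !inE (nim_odd _ g) ?inE //; split=> //.
  by apply: contraNneq evg => <-.
have nim1 : nim G [set 1] = 0.
  apply: nim_eq => [|h _|//].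
    by apply: ntA; rewrite sub1set Alt_even even1.
  rewrite inE => h1; have [odd_h|evh] := boolP (odd_perm h).
    by rewrite setUC nim1t.
  by rewrite nim_pair ?even1.
apply: nim_eq => [|g _ _|j ltj]; first by apply: ntA; apply: sub0set.
  rewrite setU0; have [odd_g|evg] := boolP (odd_perm g); first by rewrite nimt.
  by have [->|g1] := eqVneq g 1; rewrite ?nim1 ?nimc.
case: j ltj => [|[|[|//]]] _.
- by exists 1; rewrite !inE setU0.
- by exists c; rewrite !inE setU0 nimc.
by exists t; rewrite !inE setU0 nimt.
Qed.

End AchievementGames.

Theorem theorem4p3 (n : nat) (hn : 1 <= n) :
  GEN [set: 'S_n] =
    (if (n == 1) || (n == 4) then 0
     else if n == 2 then 2
     else if n == 3 then 3
     else 1).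
Proof.
have cardT : #|'I_n| = n by rewrite card_ord.
case: n hn cardT => [|[|[|[|[|n]]]]] //= _ cardT.
- by apply: GEN_trivial; apply: card1_trivg; rewrite cardsT card_Sn.
- by apply: GEN_order2; rewrite cardsT card_Sn.
- exact: GEN_perm3.
- exact: GEN_perm4.
by apply: GEN_perm_ge5; rewrite cardT.
Qed.
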